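(* Let $C$ be an arbitrary bivariate copula and let $f,g:[0,1]\to\mathbb{R}$ be functions satisfying: (G1) $f(0)=g(0)=0$, $f(1)=g(1)=0$, $f^*(1)=g^*(1)=0$; (G2) the functions $\widehat f$ and $\widehat g$ are nondecreasing on $[0,1]$; (G3) the functions $f^*$ and $g^*$ are nonincreasing on $(0,1]$; where $f^*(u)=f(u)/u$, $g^*(v)=g(v)/v$, $\widehat f(u)=u+f(u)$, $\widehat g(v)=v+g(v)$. Then the function $$T^\sigma_{f,g}(C^\sigma)(u,v)=uv\,\frac{C^\sigma(\widehat f(u),\widehat g(v))}{\widehat f(u)\,\widehat g(v)}\,\max\{0,\,1-f^*(u)g^*(v)\},\qquad (u,v)\in[0,1]^2,$$ is a copula.
   Context: For a bivariate copula $C$, the flip of $C$ in the second variable is the copula $C^\sigma(u,v)=u-C(u,1-v)$. The expression for $T^\sigma_{f,g}(C^\sigma)(u,v)$ is read as $0$ when $u=0$ or $v=0$. *)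

(* Defs.v *)
From mathcomp Require Import all_boot all_order all_algebra.
From mathcomp Require Import reals.

Set Implicit Arguments.
Unset Strict Implicit.
Unset Printing Implicit Defensive.

Import Order.TTheory GRing.Theory Num.Theory.
Local Open Scope ring_scope.

(* A function on [0,1] or [0,1]^2 is encoded as a total function on R of which
   only the values on the unit interval or square are ever constrained. *)

Record is_copula (R : realType) (C : R -> R -> R) : Prop := IsCopula {
  copula_range : {in `[0, 1] &, forall u v, C u v \in `[0, 1]} ;
  copula_ground : {in `[0, 1], forall t, C t 0 = 0 /\ C 0 t = 0} ;
  copula_margin : {in `[0, 1], forall t, C t 1 = t /\ C 1 t = t} ;
  copula_2increasing : forall u1 u2 v1 v2 : R,
    0 <= u1 -> u1 <= u2 -> u2 <= 1 -> 0 <= v1 -> v1 <= v2 -> v2 <= 1 ->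
    0 <= C u2 v2 - C u1 v2 - C u2 v1 + C u1 v1
}.

Definition flip (R : realType) (C : R -> R -> R) (u v : R) : R :=
  u - C u (1 - v).

(* [star f 0 = 0] by the convention on [0^-1]; it only matters on (0,1]. *)
Definition star (R : realType) (f : R -> R) (u : R) : R := f u / u.

Definition hat (R : realType) (f : R -> R) (u : R) : R := u + f u.

(* [D] stands for the already flipped copula. *)
Definition Tsigma (R : realType) (f g : R -> R) (D : R -> R -> R) (u v : R) : R :=
  if (u == 0) || (v == 0) then 0
  else u * v * (D (hat f u) (hat g v) / (hat f u * hat g v))
       * Num.max 0 (1 - star f u * star g v).

(* Main.v *)
Require Import Defs.
From mathcomp Require Import all_boot all_order all_algebra.
From mathcomp Require Import reals.
From mathcomp Require Import ring lra.

Import Order.TTheory GRing.Theory Num.Theory.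
Local Open Scope ring_scope.

(** For positive [u] and [v], put [p u = u / hat f u] and [q v = v / hat g v], so
    that [star f u = 1 / p u - 1] and [star g v = 1 / q v - 1].  Then [1 - star f u * star g v] equals
    [(p u + q v - 1) / (p u * q v)], and the function of the theorem becomes
    [D (hat f u) (hat g v) * W (p u) (q v)], where [D] is the flip of [C] and
    [W u v = max(0, u + v - 1)] is the lower Frechet-Hoeffding copula
    ([Tsigma_eq]).  Hypothesis (G2) says that [hat f] is nondecreasing, (G3)
    that [p] is, and [hat f u * p u = u] by construction
    ([factorization_hat]); the same holds for [g] and [q].

    It remains to see that a product [D (F1 u) (F2 v) * E (P1 u) (P2 v)] of two
    copulas is a copula as soon as the inner functions are nondecreasing and
    satisfy [F1 t * P1 t = t] and [F2 t * P2 t = t] ([is_copula_mul]).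
    Probabilistically it is the distribution function of the componentwise
    maximum of two independent random vectors; algebraically, the mixed
    difference of a product is a sum of products of values, increments and
    mixed differences of the factors, all of them nonnegative
    ([mul_2increasing]). *)

Section Copulas.
Set Implicit Arguments.
Unset Strict Implicit.
Unset Printing Implicit Defensive.

Variable R : realType.
Implicit Types (C D E : R -> R -> R) (f P F : R -> R).

(** Only the values on the unit square matter, which is how the division by
    zero on its lower and left edges is disposed of. *)
Lemma eq_is_copula C D :
  {in `[0, 1] &, forall u v, C u v = D u v} -> is_copula C -> is_copula D.
Proof.
have i0 : (0 : R) \in `[0, 1] by rewrite in_itv /= lexx ler01.
have i1 : (1 : R) \in `[0, 1] by rewrite in_itv /= lexx ler01.
move=> eqCD [rgC grC mgC incC]; split.
- by move=> u v hu hv; rewrite -eqCD //; exact: rgC.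
- by move=> t ht; rewrite -!eqCD //; exact: grC.
- by move=> t ht; rewrite -!eqCD //; exact: mgC.
- move=> u1 u2 v1 v2 u1_ge0 leu u2_le1 v1_ge0 lev v2_le1.
  by rewrite -!eqCD ?incC // in_itv /=; lra.
Qed.

(** The [C]-volume of a strip that starts on an edge where [C] vanishes is an
    increment of [C]. *)
Lemma copula_le_l C u1 u2 v : is_copula C ->
  0 <= u1 -> u1 <= u2 -> u2 <= 1 -> 0 <= v -> v <= 1 -> C u1 v <= C u2 v.
Proof.
move=> [_ grC _ incC] u1_ge0 leu u2_le1 v_ge0 v_le1.
have [|C1 _] := grC u1; first by rewrite in_itv /=; lra.
have [|C2 _] := grC u2; first by rewrite in_itv /=; lra.
by have := incC u1 u2 0 v u1_ge0 leu u2_le1 (lexx _) v_ge0 v_le1; lra.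
Qed.

Lemma copula_le_r C u v1 v2 : is_copula C ->
  0 <= u -> u <= 1 -> 0 <= v1 -> v1 <= v2 -> v2 <= 1 -> C u v1 <= C u v2.
Proof.
move=> [_ grC _ incC] u_ge0 u_le1 v1_ge0 lev v2_le1.
have [|_ C1] := grC v1; first by rewrite in_itv /=; lra.
have [|_ C2] := grC v2; first by rewrite in_itv /=; lra.
by have := incC 0 u v1 v2 (lexx _) u_ge0 u_le1 v1_ge0 lev v2_le1; lra.
Qed.

Lemma is_copula_flip C : is_copula C -> is_copula (flip C).
Proof.
move=> hC; have [rgC grC mgC incC] := hC; rewrite /flip; split.
- move=> u v; rewrite !in_itv /= => hu hv.
  have [|C1 _] := mgC u; first by rewrite in_itv.
  have : C u (1 - v) \in `[0, 1] by apply: rgC; rewrite in_itv /=; lra.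
  rewrite in_itv /= => C01.
  have : C u (1 - v) <= C u 1 by apply: copula_le_r => //; lra.
  by lra.
- move=> t; rewrite in_itv /= => ht; rewrite subr0.
  have [|-> _] := mgC t; first by rewrite in_itv.
  have [|_ ->] := grC (1 - t); first by rewrite in_itv /=; lra.
  by rewrite !subrr.
- move=> t; rewrite in_itv /= => ht; rewrite subrr.
  have [|-> _] := grC t; first by rewrite in_itv.
  have [|_ ->] := mgC (1 - t); first by rewrite in_itv /=; lra.
  by split; ring.
- move=> u1 u2 v1 v2 u1_ge0 leu u2_le1 v1_ge0 lev v2_le1.
  have := incC u1 u2 (1 - v2) (1 - v1) u1_ge0 leu u2_le1.
  by move=> /(_ ltac:(lra) ltac:(lra) ltac:(lra)); lra.
Qed.

Definition frechet_lower (u v : R) : R := Num.max 0 (u + v - 1).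

Lemma is_copula_frechet_lower : is_copula frechet_lower.
Proof.
rewrite /frechet_lower; split.
- move=> u v; rewrite !in_itv /= => hu hv.
  by case: (leP 0 (u + v - 1)) => ?; lra.
- move=> t; rewrite in_itv /= => ht.
  by split; [case: (leP 0 (t + 0 - 1)) | case: (leP 0 (0 + t - 1))] => ?; lra.
- move=> t; rewrite in_itv /= => ht.
  by split; [case: (leP 0 (t + 1 - 1)) | case: (leP 0 (1 + t - 1))] => ?; lra.
- move=> u1 u2 v1 v2 *.
  by case: (leP 0 (u1 + v1 - 1)); case: (leP 0 (u1 + v2 - 1));
     case: (leP 0 (u2 + v1 - 1)); case: (leP 0 (u2 + v2 - 1)) => *; lra.
Qed.

(** With [x], [y] the increments of the [a]'s from the corner [a11], [z] their
    mixed difference, and [x'], [y'], [z'] those of the [b]'s, the quantity is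
    [x * y' + y * x' + z * b22 + (a11 + x + y) * z']. *)
Lemma mul_2increasing (a11 a12 a21 a22 b11 b12 b21 b22 : R) :
    0 <= a11 -> a11 <= a12 -> a11 <= a21 -> 0 <= a22 - a12 - a21 + a11 ->
    0 <= b11 -> b11 <= b12 -> b11 <= b21 -> 0 <= b22 - b12 - b21 + b11 ->
  0 <= a22 * b22 - a12 * b12 - a21 * b21 + a11 * b11.
Proof.
move=> a_ge0 a12_ge a21_ge da_ge0 b_ge0 b12_ge b21_ge db_ge0.
have -> : a22 * b22 - a12 * b12 - a21 * b21 + a11 * b11 =
    (a21 - a11) * (b12 - b11) + (a12 - a11) * (b21 - b11)
    + (a22 - a12 - a21 + a11) * b22
    + (a12 + a21 - a11) * (b22 - b12 - b21 + b11) by ring.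
by rewrite !addr_ge0 ?mulr_ge0 //; lra.
Qed.

(** The condition on the inner functions that gives a product of copulas
    uniform margins; it forces both functions to take the value 1 at 1, and
    one of them to vanish at 0. *)
Record factorization F P : Prop := Factorization {
  factorization_rangel : {in `[0, 1], forall t, F t \in `[0, 1]} ;
  factorization_ranger : {in `[0, 1], forall t, P t \in `[0, 1]} ;
  factorization_homol : {in `[0, 1] &, {homo F : x y / x <= y}} ;
  factorization_homor : {in `[0, 1] &, {homo P : x y / x <= y}} ;
  factorization_mul : {in `[0, 1], forall t, F t * P t = t}
}.

Lemma factorization1 F P : factorization F P -> F 1 = 1 /\ P 1 = 1.
Proof.
have i1 : (1 : R) \in `[0, 1] by rewrite in_itv /= lexx ler01.
case=> /(_ _ i1) + /(_ _ i1) + _ _ /(_ _ i1); rewrite !in_itv /=.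
move=> /andP[F0 F1] /andP[P0 P1] FP; split; apply: le_anti.
  by rewrite F1 /= -[X in X <= _]FP ler_piMr.
by rewrite P1 /= -[X in X <= _]FP ler_piMl.
Qed.

Lemma factorization0 F P : factorization F P -> F 0 = 0 \/ P 0 = 0.
Proof.
have i0 : (0 : R) \in `[0, 1] by rewrite in_itv /= lexx ler01.
case=> _ _ _ _ /(_ _ i0) /eqP; rewrite mulf_eq0.
by case/orP => /eqP ->; [left|right].
Qed.

(** Composing with nondecreasing functions keeps each factor nonnegative and
    2-increasing, [mul_2increasing] passes this to the product, and the
    factorizations restore the margins. *)
Lemma is_copula_mul D E F1 P1 F2 P2 :
    is_copula D -> is_copula E -> factorization F1 P1 -> factorization F2 P2 ->
  is_copula (fun u v => D (F1 u) (F2 v) * E (P1 u) (P2 v)).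
Proof.
move=> hD hE fac1 fac2.
have [rgD grD mgD incD] := hD; have [rgE grE mgE incE] := hE.
have [rF1 rP1 mF1 mP1 FP1] := fac1; have [rF2 rP2 mF2 mP2 FP2] := fac2.
have [F11 P11] := factorization1 fac1; have [F21 P21] := factorization1 fac2.
split.
- move=> u v hu hv.
  have := rgD _ _ (rF1 _ hu) (rF2 _ hv); have := rgE _ _ (rP1 _ hu) (rP2 _ hv).
  rewrite !in_itv /= => /andP[E0 E1] /andP[D0 D1].
  by rewrite mulr_ge0 //= mulr_ile1.
- move=> t ht; split.
    case: (factorization0 fac2) => ->.
      by rewrite (grD _ (rF1 _ ht)).1 mul0r.
    by rewrite (grE _ (rP1 _ ht)).1 mulr0.
  case: (factorization0 fac1) => ->.
    by rewrite (grD _ (rF2 _ ht)).2 mul0r.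
  by rewrite (grE _ (rP2 _ ht)).2 mulr0.
- move=> t ht; rewrite F11 P11 F21 P21.
  rewrite (mgD _ (rF1 _ ht)).1 (mgD _ (rF2 _ ht)).2.
  by rewrite (mgE _ (rP1 _ ht)).1 (mgE _ (rP2 _ ht)).2 FP1 // FP2.
- move=> u1 u2 v1 v2 u1_ge0 leu u2_le1 v1_ge0 lev v2_le1.
  have hu1 : u1 \in `[0, 1] by rewrite in_itv /=; lra.
  have hu2 : u2 \in `[0, 1] by rewrite in_itv /=; lra.
  have hv1 : v1 \in `[0, 1] by rewrite in_itv /=; lra.
  have hv2 : v2 \in `[0, 1] by rewrite in_itv /=; lra.
  have lF1 := mF1 _ _ hu1 hu2 leu; have lP1 := mP1 _ _ hu1 hu2 leu.
  have lF2 := mF2 _ _ hv1 hv2 lev; have lP2 := mP2 _ _ hv1 hv2 lev.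
  have := rgD _ _ (rF1 _ hu1) (rF2 _ hv1).
  have := rgE _ _ (rP1 _ hu1) (rP2 _ hv1).
  move: (rF1 _ hu1) (rF1 _ hu2) (rF2 _ hv1) (rF2 _ hv2).
  move: (rP1 _ hu1) (rP1 _ hu2) (rP2 _ hv1) (rP2 _ hv2).
  rewrite !in_itv /= => /andP[? ?] /andP[? ?] /andP[? ?] /andP[? ?].
  move=> /andP[? ?] /andP[? ?] /andP[? ?] /andP[? ?] /andP[? ?] /andP[? ?].
  by apply: mul_2increasing; rewrite ?incD ?incE ?copula_le_l ?copula_le_r.
Qed.

(** Since [star f] decreases to [star f 1 = 0], it is nonnegative. *)
Lemma star_ge0 f u : star f 1 = 0 ->
    {in `]0, 1] &, {homo star f : x y /~ x <= y}} ->
  0 < u -> u <= 1 -> 0 <= star f u.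
Proof.
move=> f1 mf u_gt0 u_le1; rewrite -f1; apply: mf => //.
  by rewrite in_itv /= ltr01 lexx.
by rewrite in_itv /= u_gt0 u_le1.
Qed.

Lemma hatE f u : u != 0 -> hat f u = u * (1 + star f u).
Proof. by move=> u_neq0; rewrite /hat /star; field. Qed.

Lemma factorization_hat f : f 0 = 0 -> f 1 = 0 -> star f 1 = 0 ->
    {in `[0, 1] &, {homo hat f : x y / x <= y}} ->
    {in `]0, 1] &, {homo star f : x y /~ x <= y}} ->
  factorization (hat f) (fun u => u / hat f u).
Proof.
move=> f0 f1 sf1 mhat mstar.
have hat0 : hat f 0 = 0 by rewrite /hat f0 addr0.
have hat1 : hat f 1 = 1 by rewrite /hat f1 addr0.
have i0 : (0 : R) \in `[0, 1] by rewrite in_itv /= lexx ler01.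
have i1 : (1 : R) \in `[0, 1] by rewrite in_itv /= lexx ler01.
have ratio u : 0 < u -> u / hat f u = (1 + star f u)^-1.
  move=> u_gt0; have u_neq0 := lt0r_neq0 u_gt0.
  by rewrite hatE // invfM mulrA divff // mul1r.
have ratio_ge0 u : u \in `[0, 1] -> 0 <= u / hat f u.
  move=> hu; have := hu; rewrite in_itv /= => /andP[u_ge0 u_le1].
  by rewrite divr_ge0 // -hat0 mhat.
split=> //.
- move=> t ht; have := ht; rewrite !in_itv /= => /andP[t_ge0 t_le1].
  by rewrite -{1}hat0 -hat1 !mhat.
- move=> t ht; have := ht; rewrite !in_itv /= ratio_ge0 //= => /andP[].
  rewrite le_eqVlt => /predU1P[<- _|t_gt0 t_le1]; first by rewrite mul0r ler01.
  have := star_ge0 sf1 mstar t_gt0 t_le1 => st_ge0.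
  by rewrite ratio // invf_le1 ?lerDl //; lra.
- move=> x y hx hy lexy; move: (hx); rewrite in_itv /= => /andP[].
  rewrite le_eqVlt => /predU1P[<- _|x_gt0 x_le1].
    by rewrite mul0r ratio_ge0.
  have y_gt0 := lt_le_trans x_gt0 lexy.
  move: (hy); rewrite in_itv /= => /andP[_ y_le1].
  have sx := star_ge0 sf1 mstar x_gt0 x_le1.
  have sy := star_ge0 sf1 mstar y_gt0 y_le1.
  rewrite !ratio // lef_pV2 ?posrE; [|lra|lra].
  by rewrite lerD2l mstar // in_itv /= ?x_gt0 ?y_gt0.
- move=> t; rewrite in_itv /= => /andP[].
  rewrite le_eqVlt => /predU1P[<- _|t_gt0 t_le1]; first by rewrite mul0r mulr0.
  have st_ge0 := star_ge0 sf1 mstar t_gt0 t_le1.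
  rewrite ratio // hatE ?lt0r_neq0 // mulfK //; lra.
Qed.

(** The weight [max(0, 1 - a b) / ((1 + a) (1 + b))] is the lower
    Frechet-Hoeffding copula at [1 / (1 + a)] and [1 / (1 + b)]. *)
Lemma Tsigma_eq f g D u v : is_copula D ->
    (0 < u -> 0 <= star f u) -> (0 < v -> 0 <= star g v) ->
    f 0 = 0 -> g 0 = 0 ->
    u \in `[0, 1] -> v \in `[0, 1] ->
    hat f u \in `[0, 1] -> hat g v \in `[0, 1] ->
  D (hat f u) (hat g v) * frechet_lower (u / hat f u) (v / hat g v)
  = Tsigma f g D u v.
Proof.
move=> [_ grD _ _] sf sg f0 g0 hu hv hFu hGv; rewrite /Tsigma.
have [u0|u_neq0] := eqVneq u 0.
  by rewrite u0 /= {1}/hat f0 addr0 (grD _ hGv).2 mul0r.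
have [v0|v_neq0] := eqVneq v 0.
  by rewrite v0 /= {2}/hat g0 addr0 (grD _ hFu).1 mul0r.
move: hu hv; rewrite !in_itv /= => /andP[u_ge0 _] /andP[v_ge0 _].
have {}sf : 0 <= star f u by rewrite sf // lt_def u_neq0.
have {}sg : 0 <= star g v by rewrite sg // lt_def v_neq0.
rewrite /frechet_lower !hatE //; move: (D _ _) => d.
set a := star f u in sf *; set b := star g v in sg *.
have a1_neq0 : 1 + a != 0 by lra.
have b1_neq0 : 1 + b != 0 by lra.
have -> : u / (u * (1 + a)) + v / (v * (1 + b)) - 1
    = ((1 + a) * (1 + b))^-1 * (1 - a * b).
  by field; rewrite a1_neq0 b1_neq0 u_neq0 v_neq0.
have inv_ge0 : 0 <= ((1 + a) * (1 + b))^-1.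
  by rewrite invr_ge0 mulr_ge0 //; lra.
rewrite -[in LHS](mulr0 ((1 + a) * (1 + b))^-1) -maxr_pMr //.
by move: (Num.max _ _) => m; field; rewrite a1_neq0 b1_neq0 u_neq0 v_neq0.
Qed.

End Copulas.

Theorem proposition1 (R : realType) (C : R -> R -> R) (f g : R -> R)
  (hC : is_copula C)
  (G1 : [/\ f 0 = 0 /\ g 0 = 0, f 1 = 0 /\ g 1 = 0 & star f 1 = 0 /\ star g 1 = 0])
  (G2 : {in `[0, 1] &, {homo hat f : x y / x <= y}} /\
        {in `[0, 1] &, {homo hat g : x y / x <= y}})
  (G3 : {in `]0, 1] &, {homo star f : x y /~ x <= y}} /\
        {in `]0, 1] &, {homo star g : x y /~ x <= y}}) :
  is_copula (Tsigma f g (flip C)).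
Proof.
case: G1 G2 G3 => [[f0 g0] [f1 g1] [sf1 sg1]] [mhf mhg] [msf msg].
have hD := is_copula_flip hC.
have facf := factorization_hat f0 f1 sf1 mhf msf.
have facg := factorization_hat g0 g1 sg1 mhg msg.
have hT := is_copula_mul hD (is_copula_frechet_lower R) facf facg.
apply: eq_is_copula hT => u v hu hv.
apply: Tsigma_eq => //.
- by move: hu; rewrite in_itv /= => /andP[_ u_le1] u_gt0; exact: star_ge0.
- by move: hv; rewrite in_itv /= => /andP[_ v_le1] v_gt0; exact: star_ge0.
- exact: (factorization_rangel facf).
- exact: (factorization_rangel facg).
Qed.
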